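(* The Lie algebra $Q_{2n}$ has no non-split central extension.
   Context: All algebras are finite-dimensional over $\mathbb{C}$; brackets are antisymmetric and unlisted brackets of basis vectors are zero. $Q_{2n}$ is the $2n$-dimensional Lie algebra with basis $e_1,\dots,e_{2n}$ and $[e_i,e_1]=e_{i+1}$ for $2\le i\le 2n-2$, $[e_i,e_{2n+1-i}]=(-1)^i e_{2n}$ for $2\le i\le n$. For a nilpotent Lie algebra $N$ and a vector space $\mathbb V$, a 2-cocycle is an antisymmetric bilinear map $\psi:N\times N\to\mathbb V$ with $\psi(x,[y,z])+\psi(z,[x,y])+\psi(y,[z,x])=0$. The central extension $N_\psi$ is the space $N\oplus\mathbb V$ with bracket $[x+u,y+v]_\psi=[x,y]+\psi(x,y)$. Coboundaries are the maps $(x,y)\mapsto f([x,y])$ for linear $f:N\to\mathbb V$. Put $\operatorname{Ann}(\psi)=\{x\in N:\psi(x,N)=0\}$ and let $Z(N)$ be the center of $N$. The extension $N_\psi$ (by a nonzero finite-dimensional $\mathbb V$) is called non-split if $\operatorname{Ann}(\psi)\cap Z(N)=0$ and the cohomology classes of the components $\psi_1,\dots,\psi_s$ of $\psi$ in a basis of $\mathbb V$ ($s=\dim\mathbb V$) are linearly independent modulo coboundaries.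
   Formalization: The statement is proved for n ≥ 3; it is false for n = 1 (the Heisenberg algebra is a non-split central extension of the abelian Q_2) and for n = 2 (the cocycle with ψ(e_2,e_4) = 1 gives a non-split central extension of Q_4). *)

(* Defs.v *)
From HB Require Import structures.
From mathcomp Require Import all_boot all_order all_algebra zify.
From mathcomp Require Import reals complex.

Set Implicit Arguments.
Unset Strict Implicit.
Unset Printing Implicit Defensive.

Import Order.TTheory GRing.Theory Num.Theory.
Local Open Scope ring_scope.

(* The ground field is a numFieldType, hence of characteristic 0, so that     *)
(* antisymmetry of a bracket or a cocycle is the same as being alternating.   *)
HB.mixin Record Vector_isLieAlg (K : numFieldType) L of Vector K L := {
  lie : L -> L -> L;
  lie_bilinear : bilinear_for *:%R *:%R lie;
  lie_antisym : forall x y, lie x y = - lie y x;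
  lie_jacobi : forall x y z,
    lie x (lie y z) + lie z (lie x y) + lie y (lie z x) = 0
}.

#[short(type="lieAlgType")]
HB.structure Definition LieAlg (K : numFieldType) :=
  { L of Vector K L & Vector_isLieAlg K L }.

Section Cohomology.
Variables (K : numFieldType) (N : lieAlgType K).

Record cocycle (V : vectType K) := Cocycle {
  cocycle_fun :> {bilinear N -> N -> V};
  cocycle_antisym : forall x y, cocycle_fun x y = - cocycle_fun y x;
  cocycle_jacobi : forall x y z,
    cocycle_fun x (lie y z) + cocycle_fun z (lie x y)
      + cocycle_fun y (lie z x) = 0
}.

Definition is_coboundary (V : vectType K) (psi : N -> N -> V) : Prop :=
  exists f : {linear N -> V}, forall x y, psi x y = f (lie x y).

Definition in_Ann (V : vectType K) (psi : N -> N -> V) (x : N) : Prop :=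
  forall y, psi x y = 0.

Definition in_center (x : N) : Prop := forall y, lie x y = 0.

Definition component (V : vectType K) (s : nat) (b : s.-tuple V)
    (psi : N -> N -> V) (i : 'I_s) : N -> N -> K^o :=
  fun x y => coord b i (psi x y).

Definition free_mod_coboundaries (s : nat) (phi : 'I_s -> N -> N -> K^o) : Prop :=
  forall c : 'I_s -> K,
    is_coboundary (fun x y => \sum_(i < s) c i *: phi i x y) ->
    forall i, c i = 0.

Definition nonsplit (V : vectType K) (psi : cocycle V) : Prop :=
  (forall x, in_Ann psi x -> in_center x -> x = 0)
  /\ exists b : (\dim {:V}).-tuple V,
       basis_of fullv b /\ free_mod_coboundaries (component b psi).

End Cohomology.

Section CentralExtension.
Variables (K : numFieldType) (N : lieAlgType K) (V : vectType K).

Definition central_ext (psi : cocycle N V) : Type := (N * V)%type.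

Variable psi : cocycle N V.

HB.instance Definition _ := Vector.copy (central_ext psi) (N * V)%type.

Definition ext_lie (p q : central_ext psi) : central_ext psi :=
  (lie p.1 q.1, psi p.1 q.1).

Lemma ext_lie_bilinear : bilinear_for *:%R *:%R ext_lie.
Proof.
have [bl br] := @lie_bilinear K N.
by split=> p a q r; congr pair; rewrite /= ?(bl _ a) ?(br _ a) // ?linearPl ?linearPr.
Qed.

Lemma ext_lie_antisym p q : ext_lie p q = - ext_lie q p.
Proof. by congr pair; [apply: lie_antisym | apply: cocycle_antisym]. Qed.

Lemma ext_lie_jacobi p q r :
  ext_lie p (ext_lie q r) + ext_lie r (ext_lie p q) + ext_lie q (ext_lie r p)
    = 0.
Proof. by congr pair; [apply: lie_jacobi | apply: cocycle_jacobi]. Qed.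

HB.instance Definition _ := Vector_isLieAlg.Build K (central_ext psi)
  ext_lie_bilinear ext_lie_antisym ext_lie_jacobi.

End CentralExtension.

Definition nonsplit_central_extension (K : numFieldType)
    (N E : lieAlgType K) : Prop :=
  exists (V : vectType K) (psi : cocycle N V),
    [/\ (0 < \dim {:V})%N, nonsplit psi
      & E = (central_ext psi : lieAlgType K)].

Section Q.
Variables (K : numFieldType) (n : nat).

Definition Q : Type := 'rV[K]_(2 * n).

HB.instance Definition _ := Vector.copy Q 'rV[K]_(2 * n).

(* Indices run from 1 to 2n; Qe k is 0 for k outside this range. *)
Definition Qe (k : nat) : Q := \row_(j < 2 * n) (j.+1 == k)%:R.

(* The listed brackets [e_i, e_j]; no pair (i, j) meets both conditions, and  *)
(* (i, j), (j, i) are never both listed.                                      *)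
Definition Qlisted (i j : nat) : Q :=
  if (2 <= i <= 2 * n - 2)%N && (j == 1%N) then Qe i.+1
  else if (2 <= i <= n)%N && (i + j == 2 * n + 1)%N then
    (-1) ^+ i *: Qe (2 * n)
  else 0.

Definition Qtable (i j : nat) : Q := Qlisted i j - Qlisted j i.

Definition Qlie (x y : Q) : Q :=
  \sum_(i < 2 * n) \sum_(j < 2 * n) (x 0 i * y 0 j) *: Qtable i.+1 j.+1.

Lemma Qlie_bilinear : bilinear_for *:%R *:%R Qlie.
Proof.
split=> u a x y; rewrite /Qlie /= scaler_sumr -big_split; apply: eq_bigr => i _;
  rewrite scaler_sumr -big_split; apply: eq_bigr => j _; rewrite /= !mxE.
- by rewrite scalerA -scalerDl mulrDl mulrA.
- by rewrite scalerA -scalerDl mulrDr mulrCA.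
Qed.

Lemma Qlie_antisym x y : Qlie x y = - Qlie y x.
Proof.
rewrite /Qlie exchange_big -sumrN; apply: eq_bigr => i _.
rewrite -sumrN; apply: eq_bigr => j _.
by rewrite -scalerN /Qtable opprB mulrC.
Qed.

Lemma Qlie_basis i j : (1 <= i <= 2 * n)%N -> (1 <= j <= 2 * n)%N ->
  Qlie (Qe i) (Qe j) = Qtable i j.
Proof.
case: i j => [|i] [|j] //= hi hj.
rewrite /Qlie (bigD1 (Ordinal hi)) //= (bigD1 (Ordinal hj)) //= !mxE !eqxx.
rewrite mulr1 scale1r !big1 ?addr0 // => [k nk|k nk]; first rewrite big1 // => l _.
  by rewrite !mxE eqSS -[in k == i :> nat](erefl : nat_of_ord (Ordinal hi) = i)
             val_eqE (negPf nk) mul0r scale0r.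
by rewrite !mxE !eqSS -[in k == j :> nat](erefl : nat_of_ord (Ordinal hj) = j)
           val_eqE (negPf nk) mulr0 scale0r.
Qed.

Lemma Qlie_e1 i : (2 <= i <= 2 * n - 2)%N -> Qlie (Qe i) (Qe 1) = Qe i.+1.
Proof.
move=> hi; rewrite Qlie_basis; [|lia|lia].
rewrite /Qtable /Qlisted hi eqxx /=.
by rewrite subr0.
Qed.

Lemma Qtable_1 i : Qtable i 1 = if (2 <= i <= 2 * n - 2)%N then Qe i.+1 else 0.
Proof.
have L0 : Qlisted 1 i = 0 by [].
rewrite /Qtable L0 subr0 /Qlisted eqxx andbT.
by case: ifP => // h; rewrite ifF //; lia.
Qed.

Lemma Qtable_ge2 i j : (2 <= i)%N -> (2 <= j)%N ->
  Qtable i j = if (i + j == 2 * n + 1)%N then (-1) ^+ i *: Qe (2 * n) else 0.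
Proof.
move=> hi hj; rewrite /Qtable /Qlisted.
rewrite ifF; last lia.
rewrite [X in _ - X]ifF; last lia.
rewrite [(j + i)%N]addnC.
case: eqP => [hij|_]; last by rewrite !andbF subr0.
rewrite !andbT; case: (leqP i n) => hin.
  by rewrite hi /= ifF ?subr0 //; lia.
rewrite ifF; last lia.
rewrite ifT; last lia.
rewrite sub0r -scaleNr; congr (_ *: _).
rewrite -signr_odd -[RHS]signr_odd.
have -> : odd i = ~~ odd j by lia.
by case: (odd j); rewrite /= ?expr1 ?expr0 ?opprK.
Qed.

Lemma Qlie_mid i : (2 <= i <= n)%N ->
  Qlie (Qe i) (Qe (2 * n + 1 - i)) = (-1) ^+ i *: Qe (2 * n).
Proof.
move=> hi; rewrite Qlie_basis; [|lia|lia].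
by rewrite Qtable_ge2 ?ifT //; lia.
Qed.

Lemma Qtable_antisym i j : Qtable i j = - Qtable j i.
Proof. by rewrite /Qtable opprB. Qed.

Lemma Qe_expand (x : Q) : x = \sum_(i < 2 * n) x 0 i *: Qe i.+1.
Proof.
apply/rowP=> j; rewrite summxE (bigD1 j) //= !mxE eqxx mulr1.
rewrite big1 ?addr0 // => i ni.
by rewrite !mxE eqSS [(j == i :> nat)]eq_sym val_eqE (negPf ni) mulr0.
Qed.

Lemma Qlinear0 (f : Q -> Q) : linear f ->
  (forall i, (1 <= i <= 2 * n)%N -> f (Qe i) = 0) -> forall x, f x = 0.
Proof.
move=> lf f0 x; pose F : {linear Q -> Q} :=
  HB.pack f (GRing.isLinear.Build _ _ _ _ f lf).
rewrite -[f x]/(F x) [x]Qe_expand linear_sum big1 // => i _.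
by rewrite linearZ /= f0 ?scaler0 //; have := ltn_ord i; lia.
Qed.

Let J x y z := Qlie x (Qlie y z) + Qlie z (Qlie x y) + Qlie y (Qlie z x).

Let J_rot x y z : J x y z = J y z x.
Proof. by rewrite /J addrC addrA. Qed.

Let Qlie0r x : Qlie x 0 = 0.
Proof. by have := Qlie_bilinear.2 x (-1) 0 0; rewrite /= scaler0 addr0 scaleN1r addNr. Qed.

Let QlieZr x a y : Qlie x (a *: y) = a *: Qlie x y.
Proof. by have := Qlie_bilinear.2 x a y 0; rewrite /= Qlie0r !addr0. Qed.

Let QlieNr x y : Qlie x (- y) = - Qlie x y.
Proof. by rewrite -scaleN1r QlieZr scaleN1r. Qed.

Let J_linear y z : linear (fun x => J x y z).
Proof.
have bl w a x x' : Qlie (a *: x + x') w = a *: Qlie x w + Qlie x' w.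
  exact: Qlie_bilinear.1.
have br w a x x' : Qlie w (a *: x + x') = a *: Qlie w x + Qlie w x'.
  exact: Qlie_bilinear.2.
move=> a u v; rewrite /J !bl !br.
by rewrite !(addrACA (a *: _) _ (a *: _), =^~ scalerDr).
Qed.

Let Qlie_nested p q r : (1 <= p <= 2 * n)%N -> (2 <= q <= 2 * n)%N ->
  (2 <= r <= 2 * n)%N -> Qlie (Qe p) (Qlie (Qe q) (Qe r)) = 0.
Proof.
move=> hp hq hr; rewrite [Qlie (Qe q) _]Qlie_basis; [|lia|lia].
rewrite Qtable_ge2; [|lia|lia].
case: ifP => _; last exact: Qlie0r.
rewrite QlieZr Qlie_basis; [|lia|lia].
have [->|p1] := eqVneq p 1%N.
  by rewrite Qtable_antisym Qtable_1 ifF ?oppr0 ?scaler0 //; lia.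
by rewrite Qtable_ge2 ?ifF ?scaler0 //; lia.
Qed.

Let J_basis1 j k : (1 <= j <= 2 * n)%N -> (1 <= k <= 2 * n)%N ->
  J (Qe 1) (Qe j) (Qe k) = 0.
Proof.
move=> hj hk.
have lie11 : Qlie (Qe 1) (Qe 1) = 0.
  by rewrite Qlie_basis; [rewrite /Qtable subrr|lia|lia].
rewrite /J.
have [->|j1] := eqVneq j 1%N.
  by rewrite lie11 Qlie0r addr0 [X in _ + Qlie _ X]Qlie_antisym QlieNr subrr.
have [->|k1] := eqVneq k 1%N.
  by rewrite lie11 Qlie0r addr0 [X in Qlie _ X + _]Qlie_antisym QlieNr addNr.
rewrite Qlie_nested ?add0r; [|lia|lia|lia].
rewrite [Qlie (Qe 1) _]Qlie_antisym QlieNr !Qlie_basis; [|lia..].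
rewrite !Qtable_1.
have E p q : (2 <= p <= 2 * n)%N -> (2 <= q <= 2 * n)%N ->
    Qlie (Qe p) (if (2 <= q <= 2 * n - 2)%N then Qe q.+1 else 0)
    = if (p + q == 2 * n)%N then (-1) ^+ p *: Qe (2 * n) else 0.
  move=> hp hq; case: ifP => h; last by rewrite Qlie0r ifF //; lia.
  rewrite Qlie_basis; [|lia|lia]; rewrite Qtable_ge2; [|lia|lia].
  by congr (if _ then _ else _); lia.
rewrite !E; [|lia..]; rewrite [(j + k)%N]addnC.
case: eqP => h; last by rewrite oppr0 addr0.
rewrite -signr_odd -[X in _ + X *: _]signr_odd.
have -> : odd k = odd j by lia.
exact: addNr.
Qed.

Lemma Qlie_jacobi x y z :
  Qlie x (Qlie y z) + Qlie z (Qlie x y) + Qlie y (Qlie z x) = 0.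
Proof.
rewrite -/(J x y z); move: x; apply: Qlinear0; first exact: J_linear.
move=> i hi; rewrite J_rot; move: y; apply: Qlinear0; first exact: J_linear.
move=> j hj; rewrite J_rot; move: z; apply: Qlinear0; first exact: J_linear.
move=> k hk.
have [->|k1] := eqVneq k 1%N; first exact: J_basis1.
have [->|i1] := eqVneq i 1%N; first by rewrite J_rot J_basis1.
have [->|j1] := eqVneq j 1%N; first by rewrite -J_rot J_basis1.
by rewrite /J !Qlie_nested ?addr0 //; lia.
Qed.

HB.instance Definition _ := Vector_isLieAlg.Build K Q
  Qlie_bilinear Qlie_antisym Qlie_jacobi.

End Q.

(* Main.v *)
Require Import Defs.
From HB Require Import structures.
From mathcomp Require Import all_boot all_order all_algebra reals complex.
From mathcomp Require Import zify.

Set Implicit Arguments.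
Unset Strict Implicit.
Unset Printing Implicit Defensive.

Import GRing.Theory Num.Theory.
Local Open Scope ring_scope.

(** A non-split extension would force the cocycle to be nondegenerate on the
    center of Q_{2n}, which contains the nonzero vector e_{2n}.  But every
    2-cocycle psi kills e_{2n} as soon as 3 <= n, so no such extension exists.

    To see that psi(e_k, e_{2n}) = 0, write e_{2n} as a bracket, up to sign, of
    e_i and e_j with i + j = 2n + 1 and use the cocycle identity on e_k, e_i,
    e_j.
    - For 2 <= k there are at least two pairs {i, j} to choose from, namely
      {2, 2n - 1} and {3, 2n - 2}; a pair avoiding k makes the two other terms
      of the identity vanish (cocycle_Qe_ge2).
    - For k = 1 the identity relates P = psi(e_1, e_{2n}) to the values
      a_i = psi(e_i, e_{2n+2-i}): it says that (-1)^i a_i is an arithmetic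
      progression of step P, and a_2 = 0 by the first case, so that
      (-1)^i a_i = (i - 2) P (cocycle_antidiagonal).  As psi is
      alternating, a_{n+1} = psi(e_{n+1}, e_{n+1}) = 0, whence (n - 1) P = 0
      and P = 0 in characteristic 0 (cocycle_Qe1). *)

Section Cocycles.
Variables (K : numFieldType) (n : nat) (V : vectType K).
Variable psi : cocycle (Q K n : lieAlgType K) V.

Local Notation e := (Qe K n).

Lemma cocycle_eq0 (x : Q K n) :
  (forall k, (1 <= k <= 2 * n)%N -> psi (e k) x = 0) ->
  forall y, psi x y = 0.
Proof.
move=> h y; rewrite cocycle_antisym [y]Qe_expand linear_sumlz big1 ?oppr0 //.
move=> i _; rewrite linearZl_LR /= h ?scaler0 //.
by have := ltn_ord i; lia.
Qed.

Lemma lie_Qe i j : (1 <= i <= 2 * n)%N -> (1 <= j <= 2 * n)%N ->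
  lie (e i : Q K n) (e j) = Qtable K n i j.
Proof. exact: Qlie_basis. Qed.

(** Neither k + i nor k + j equals 2n + 1, so the identity on e_k, e_i, e_j keeps
    only the term in [e_i, e_j], which is e_{2n} up to sign. *)
Lemma cocycle_Qe_offpair k i j : (2 <= k <= 2 * n)%N ->
  (2 <= i)%N -> (2 <= j)%N -> (i + j = 2 * n + 1)%N -> k != i -> k != j ->
  psi (e k) (e (2 * n)) = 0.
Proof.
move=> hk hi hj hij ki kj.
have := cocycle_jacobi psi (e k) (e i) (e j).
rewrite !lie_Qe; [|lia..].
rewrite !Qtable_ge2; [|lia..].
rewrite ifT; last lia.
rewrite ifF; last lia.
rewrite ifF; last lia.
rewrite !linear0r !addr0 linearZr_LR => /eqP.
by rewrite scaler_eq0 signr_eq0 => /eqP.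
Qed.

Lemma cocycle_Qe_ge2 k : (3 <= n)%N -> (2 <= k <= 2 * n)%N ->
  psi (e k) (e (2 * n)) = 0.
Proof.
move=> hn hk; have [k2|k2] := boolP ((k == 2) || (k == (2 * n - 1)%N)).
  by apply: (@cocycle_Qe_offpair _ 3 (2 * n - 2)); lia.
by apply: (@cocycle_Qe_offpair _ 2 (2 * n - 1)); lia.
Qed.

Lemma cocycle_Qe1_step i : (3 <= n)%N -> (2 <= i <= 2 * n - 2)%N ->
  psi (e i.+1) (e (2 * n + 1 - i)) =
  - ((-1) ^+ i *: psi (e 1) (e (2 * n)) + psi (e i) (e (2 * n + 2 - i))).
Proof.
move=> hn hi.
have := cocycle_jacobi psi (e 1) (e i) (e (2 * n + 1 - i)).
rewrite !lie_Qe; [|lia..].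
rewrite Qtable_ge2; [|lia|lia].
rewrite ifT; last lia.
rewrite (Qtable_antisym _ _ 1) !Qtable_1 hi linearZr_LR /=.
have -> : psi (e i) (if (2 <= 2 * n + 1 - i <= 2 * n - 2)%N
                     then e (2 * n + 1 - i).+1 else 0)
          = psi (e i) (e (2 * n + 2 - i)).
  case: ifP => h; first by congr (psi _ (e _)); lia.
  (* Here i = 2, where [e_{2n-1}, e_1] is 0 and not e_{2n}. *)
  have -> : (2 * n + 2 - i = 2 * n)%N by lia.
  by rewrite linear0r cocycle_Qe_ge2 //; lia.
rewrite linearNr /= -cocycle_antisym addrAC addrC => /eqP.
by rewrite addr_eq0 => /eqP.
Qed.

(** The cocycle identity on e_1, e_i, e_{2n+1-i} makes the signed values along
    the antidiagonal increase by psi(e_1, e_{2n}) at each step; the progression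
    starts from psi(e_2, e_{2n}) = 0. *)
Lemma cocycle_antidiagonal k : (3 <= n)%N -> (k <= 2 * n - 3)%N ->
  psi (e k.+2) (e (2 * n - k)) =
  ((-1) ^+ k * k%:R) *: psi (e 1) (e (2 * n)).
Proof.
move=> hn; elim: k => [|k IHk] hk.
  by rewrite mulr0 scale0r subn0 cocycle_Qe_ge2 //; lia.
have -> : (2 * n - k.+1 = 2 * n + 1 - k.+2)%N by lia.
rewrite cocycle_Qe1_step; [|lia|lia].
have -> : (2 * n + 2 - k.+2 = 2 * n - k)%N by lia.
rewrite IHk; last lia.
rewrite -scalerDl -scaleNr !exprS mulN1r mulN1r opprK; congr (_ *: _).
by rewrite mulNr -natr1 mulrDr mulr1 [in RHS]addrC.
Qed.

(** At the middle of the antidiagonal the two arguments of psi coincide, so that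
    the progression takes the value 0 after n - 1 steps. *)
Lemma cocycle_Qe1 : (3 <= n)%N -> psi (e 1) (e (2 * n)) = 0.
Proof.
move=> hn; have := @cocycle_antidiagonal n.-1 hn.
have -> : (2 * n - n.-1 = n.-1.+2)%N by lia.
have -> : psi (e n.-1.+2) (e n.-1.+2) = 0.
  set u := psi _ _; have /eqP : 2%:R *: u = 0.
    by rewrite scaler_nat mulr2n {1}/u cocycle_antisym addNr.
  by rewrite scaler_eq0 pnatr_eq0 => /eqP.
move=> /(_ ltac:(lia))/esym/eqP; rewrite scaler_eq0 mulf_eq0 signr_eq0 pnatr_eq0.
by case/orP=> [|/eqP //]; lia.
Qed.

Lemma in_Ann_Qe_last : (3 <= n)%N -> in_Ann psi (e (2 * n)).
Proof.
move=> hn; apply: cocycle_eq0 => k hk.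
have [->|k1] := eqVneq k 1%N; first exact: cocycle_Qe1.
by rewrite cocycle_Qe_ge2 //; lia.
Qed.

End Cocycles.

Section Center.
Variables (K : numFieldType) (n : nat).

Lemma in_center_Qe_last : (3 <= n)%N ->
  in_center (Qe K n (2 * n) : (Q K n : lieAlgType K)).
Proof.
move=> hn; apply: (Qlinear0 (f := lie (Qe K n (2 * n) : Q K n))).
  move=> a y z; exact: (Qlie_bilinear K n).2.
move=> k hk; rewrite lie_Qe; [|lia..].
have [->|k1] := eqVneq k 1%N; first by rewrite Qtable_1 ifF //; lia.
by rewrite Qtable_ge2 ?ifF //; lia.
Qed.

Lemma Qe_neq0 i : (1 <= i <= 2 * n)%N -> Qe K n i != 0.
Proof.
case: i => // i /= hi; apply/eqP => /rowP/(_ (Ordinal hi)).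
by rewrite !mxE eqxx => /eqP; rewrite oner_eq0.
Qed.

End Center.

Theorem mainTheorem2 (R : realType) (n : nat) (hn : (3 <= n)%N) :
  ~ exists E : lieAlgType R[i],
      nonsplit_central_extension (Q R[i] n : lieAlgType R[i]) E.
Proof.
case=> E [V [psi [_ [nondeg _] _]]].
have := nondeg _ (in_Ann_Qe_last psi hn) (in_center_Qe_last hn).
by apply/eqP; apply: Qe_neq0; lia.
Qed.
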